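(* Let $p(z)$ be a complex polynomial of degree $n \geq 1$, and let $F(z)=|p(z)|^2=p(z)\overline{p(z)}$ for $z \in \mathbb{C}$. Let $z_0 \in \mathbb{C}$ with $p(z_0)\neq 0$. Let $k \geq 1$ be the smallest index (positive integer) with $p^{(k)}(z_0)\neq 0$, and let $$u=\frac{1}{k!}\,p(z_0)\,\overline{p^{(k)}(z_0)}.$$ Define the real numbers $\gamma = u^{k-1}+\overline{u}^{\,k-1}$ and $\delta = i\,(u^{k-1}-\overline{u}^{\,k-1})$, and let $G_k(z)=\overline{u}z^k+u\overline{z}^k$. Then for every real $\theta$ there is a polynomial $q(\alpha)$ in the variable $\alpha$, of degree $2n$ and having $\alpha^{l}$ as a factor for some integer $l>k$, such that for every real $\alpha>0$, $$F(z_0+\alpha e^{i\theta}u)-F(z_0)=|p(z_0+\alpha e^{i\theta}u)|^2-|p(z_0)|^2=G_k(\alpha e^{i\theta}u)+q(\alpha),$$ where $$G_k(\alpha e^{i\theta}u)=\alpha^k|u|^2\,(\gamma\cos k\theta+\delta\sin k\theta).$$ In particular, $\theta \in \mathbb{R}$ can be selected so that $e^{i\theta}u$ is a descent direction for $F$ at $z_0$.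
   Context: Here $p^{(k)}$ denotes the $k$-th derivative of $p$. A complex number $d$ is a descent direction for $F:\mathbb{C}\to\mathbb{R}$ at a point $z_0\in\mathbb{C}$ if there is a positive real number $\alpha_*$ such that $F(z_0+\alpha d)<F(z_0)$ for all $\alpha\in(0,\alpha_* )$. *)

(* Defs.v *)
From HB Require Import structures.
From mathcomp Require Export all_boot all_order all_algebra.
From mathcomp Require Export reals trigo.
From mathcomp Require Export complex.

Set Implicit Arguments.
Unset Strict Implicit.
Unset Printing Implicit Defensive.

Export Order.TTheory GRing.Theory Num.Theory.
Export ComplexField.

(* ring_scope is opened last, so that [^*] and ['i] are the ones of
   numClosedFieldType (on R[i] they are convertible to those of complex_scope). *)
Open Scope complex_scope.
Open Scope ring_scope.

(* Normc.normc is the modulus with values in R; the generic norm [`|_|] of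
   R[i] takes its values in R[i]: [`|z| = (Normc.normc z)%:C]. *)
Definition sqmod (R : realType) (p : {poly R[i]}) (z : R[i]) : R :=
  Normc.normc p.[z] ^+ 2.

Definition expi (R : realType) (t : R) : R[i] := cos t +i* sin t.

Definition descent_direction (R : realType) (F : R[i] -> R) (z0 d : R[i]) :
    Prop :=
  exists2 amax : R, 0 < amax &
    forall a : R, 0 < a -> a < amax -> F (z0 + a%:C * d) < F z0.

Definition smallest_nonvanishing_derivative (R : realType) (p : {poly R[i]})
    (z0 : R[i]) (k : nat) : Prop :=
  [/\ (0 < k)%N, p^`(k).[z0] != 0 &
      forall j : nat, (0 < j)%N -> p^`(j).[z0] != 0 -> (k <= j)%N].

Definition Gk (R : realType) (k : nat) (u z : R[i]) : R[i] :=
  u^* * z ^+ k + u * (z^*) ^+ k.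

(* Main.v *)
From mathcomp Require Import ring lra.
Require Import Defs.

(** Along the line z0 + a v, the real and imaginary parts of p are real
    polynomials A and B in a, so F is the real polynomial A^2 + B^2, whose
    coefficient of a^(2n) is |lead(p) v^n|^2 <> 0.  By Taylor's formula A and B
    have no terms of degree strictly between 0 and k, so squaring leaves a
    constant, the term 2 Re (p(z0)^* c_k v^k) a^k and multiples of a^(k+1).
    For v = e^(i theta) u the coefficient of a^k is
    2 |u|^2 Re (u^(k-1) e^(i k theta)), which is negative for a suitable theta;
    it then decides the sign for small a > 0. *)

Set Implicit Arguments.
Unset Strict Implicit.
Unset Printing Implicit Defensive.

(** Write A = a + b X^k + D X^(k+1). In the square only a^2 and 2ab X^k escape divisibility by
    X^(k+1), because 2k >= k+1 when k > 0. *)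
Lemma sqr_poly_gap (R : fieldType) (A : {poly R}) (k : nat) :
    (0 < k)%N -> (forall j, (0 < j < k)%N -> A`_j = 0) ->
  'X^(k.+1) %| A ^+ 2 - (A`_0 ^+ 2)%:P - (2 * A`_0 * A`_k) *: 'X^k.
Proof.
case: k => // k _ gap.
have takeA : take_poly k.+2 A = (A`_0)%:P + A`_k.+1 *: 'X^(k.+1).
  apply/polyP => -[|j]; rewrite coef_take_poly coefD coefZ coefC coefXn /=.
    by rewrite mulr0 addr0.
  rewrite add0r eqSS !ltnS; case: (ltngtP j k) => [lt_jk||->]; rewrite ?mulr0 ?mulr1 //.
  by rewrite gap.
rewrite -{1}(poly_take_drop k.+2 A) takeA; set D := drop_poly _ _.
rewrite -!mul_polyC !expr2 !polyCM -/(2%:R) polyC_natr !exprS.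
set a := (A`_0)%:P; set b := (A`_k.+1)%:P.
(* After the case split [k] stands for the former k - 1, so the divisor is X^(k+2); this is the
   quotient read off from the expanded square. *)
apply/dvdpP; exists (b ^+ 2 * 'X^k + 2 * (a + b * ('X * 'X^k)) * D + D ^+ 2 * ('X * ('X * 'X^k))).
by ring.
Qed.

Lemma sum_sqr_neq0 (R : realDomainType) (x y : R) :
  (x != 0) || (y != 0) -> x ^+ 2 + y ^+ 2 != 0.
Proof. by rewrite paddr_eq0 ?sqr_ge0 // !sqrf_eq0 negb_and. Qed.

(** In the convolution two indices with sum 2n either both equal n or one exceeds n, where [A] has
    coefficient 0. *)
Lemma coef_sqr_last (R : nzRingType) (A : {poly R}) (n : nat) :
  (size A <= n.+1)%N -> (A ^+ 2)`_(2 * n) = A`_n ^+ 2.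
Proof.
move=> szA; rewrite !expr2 mul2n -addnn coefM (bigD1 (inord n)) //=.
rewrite inordK ?ltnS ?leq_addr // addnK big1 ?addr0 // => i ne_i.
have [lt_in|] := ltnP i n.
  rewrite [X in _ * X]nth_default ?mulr0 // (leq_trans szA) //.
  by rewrite ltn_subRL ltn_add2r.
rewrite leq_eqVlt => /orP[/eqP eq_ni|lt_ni].
  by case/eqP: ne_i; apply: val_inj; rewrite /= inordK ?ltnS ?leq_addr.
by rewrite nth_default ?mul0r // (leq_trans szA).
Qed.

(** Over an ordered domain the squares of the two coefficients of index n cannot cancel, so the
    degree is exactly 2n even if one of them is zero. *)
Lemma size_add_sqr (R : realDomainType) (A B : {poly R}) (n : nat) :
    (size A <= n.+1)%N -> (size B <= n.+1)%N -> (A`_n != 0) || (B`_n != 0) ->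
  size (A ^+ 2 + B ^+ 2) = (2 * n).+1.
Proof.
move=> szA szB lead_n0; apply/eqP; rewrite eqn_leq; apply/andP; split.
  have szX (C : {poly R}) : (size C <= n.+1)%N -> (size (C ^+ 2) <= (2 * n).+1)%N.
    move=> szC; apply: leq_trans (size_poly_exp_leq _ _) _.
    by rewrite mulnC ltnS leq_mul2l -subn1 leq_subLR add1n.
  by apply: leq_trans (size_polyD _ _) _; rewrite geq_max !szX.
rewrite ltnNge; apply/negP => /leq_sizeP/(_ _ (leqnn _))/eqP.
rewrite coefD !coef_sqr_last //; apply/negP; exact: sum_sqr_neq0.
Qed.

(** Taking real parts is additive but not multiplicative; it passes through evaluation because the
    powers of [a] are real scalars. *)
Lemma Re_horner_real (R : rcfType) (P : {poly R[i]}) (a : R) :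
  complex.Re P.[a%:C] = (map_poly (@complex.Re R) P).[a].
Proof.
have szle : (size (map_poly (@complex.Re R) P) <= size P)%N by exact: size_poly.
rewrite horner_coef (horner_coef_wide _ szle).
rewrite (big_morph (@complex.Re R) (id1 := 0) (op1 := +%R)) //; last by case=> ? ? [].
apply: eq_bigr => i _; rewrite coef_map_id0 // -rmorphXn.
by case: (P`_i) => x y /=; rewrite mulr0 subr0.
Qed.

Lemma Im_horner_real (R : rcfType) (P : {poly R[i]}) (a : R) :
  complex.Im P.[a%:C] = (map_poly (@complex.Im R) P).[a].
Proof.
have szle : (size (map_poly (@complex.Im R) P) <= size P)%N by exact: size_poly.
rewrite horner_coef (horner_coef_wide _ szle).
rewrite (big_morph (@complex.Im R) (id1 := 0) (op1 := +%R)) //; last by case=> ? ? [].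
apply: eq_bigr => i _; rewrite coef_map_id0 // -rmorphXn.
by case: (P`_i) => x y /=; rewrite mulr0 add0r.
Qed.

Lemma sqr_normcE (R : rcfType) (z : R[i]) :
  Normc.normc z ^+ 2 = complex.Re z ^+ 2 + complex.Im z ^+ 2.
Proof. by case: z => x y; rewrite sqr_sqrtr // addr_ge0 ?sqr_ge0. Qed.

Lemma normc_lift (R : rcfType) (z : R[i]) : (Normc.normc z ^+ 2)%:C = `|z| ^+ 2.
Proof. by rewrite rmorphXn. Qed.

Lemma sqmod_along_line (R : realType) (p : {poly R[i]}) (n : nat)
    (z0 v : R[i]) (k : nat) :
    size p = n.+1 -> v != 0 -> (0 < k < 2 * n)%N ->
    (forall j, (0 < j < k)%N -> p^`N(j).[z0] = 0) ->
  exists q : {poly R}, [/\ size q = (2 * n).+1, 'X^(k.+1) %| q &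
    forall a : R, sqmod p (z0 + a%:C * v) - sqmod p z0
      = 2 * complex.Re (p.[z0]^* * p^`N(k).[z0] * v ^+ k) * a ^+ k + q.[a]].
Proof.
move=> szp v0 /andP[k0 lt_k2n] gap.
(* [P] is the polynomial a |-> p(z0 + a v): its coefficients are the Taylor coefficients of [p] at
   [z0], scaled by powers of [v]. *)
pose P := \poly_(i < n.+1) (p^`N(i).[z0] * v ^+ i).
have PE i : P`_i = p^`N(i).[z0] * v ^+ i.
  rewrite coef_poly; case: ltnP => // le_ni.
  suff -> : p^`N(i) = 0 by rewrite horner0 mul0r.
  apply/polyP => j; rewrite coef_nderivn coef0 nth_default ?mul0rn // szp.
  by rewrite (leq_trans le_ni) ?leq_addr.
have Pa a : P.[a%:C] = p.[z0 + a%:C * v].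
  rewrite nderiv_taylor ?szp; last exact: mulrC.
  rewrite horner_poly; apply: eq_bigr => i _.
  by rewrite exprMn mulrA mulrAC.
have P0 : P`_0 = p.[z0] by rewrite PE nderivn0 mulr1.
have Pn : P`_n != 0.
  rewrite PE mulf_neq0 ?expf_neq0 //.
  have -> : p^`N(n) = (lead_coef p)%:P.
    apply/polyP => j; rewrite coef_nderivn coefC lead_coefE szp /=.
    case: j => [|j]; first by rewrite addn0 binn.
    by rewrite nth_default ?mul0rn // szp addnS ltnS leq_addr.
  by rewrite hornerC lead_coef_eq0 -size_poly_eq0 szp.
have szP : (size P <= n.+1)%N by exact: size_poly.
pose A := map_poly (@complex.Re R) P; pose B := map_poly (@complex.Im R) P.
have AE i : A`_i = complex.Re P`_i by rewrite coef_map_id0.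
have BE i : B`_i = complex.Im P`_i by rewrite coef_map_id0.
have szA : (size A <= n.+1)%N by apply: leq_trans szP; exact: size_poly.
have szB : (size B <= n.+1)%N by apply: leq_trans szP; exact: size_poly.
have szAB : size (A ^+ 2 + B ^+ 2) = (2 * n).+1.
  apply: size_add_sqr => //; rewrite AE BE; apply: contraNT Pn.
  rewrite negb_or !negbK => /andP[/eqP re0 /eqP im0]; apply/eqP.
  by case: (P`_n) re0 im0 => x y /= -> ->.
pose g := 2 * (A`_0 * A`_k + B`_0 * B`_k).
pose c := A`_0 ^+ 2 + B`_0 ^+ 2.
exists (A ^+ 2 + B ^+ 2 - (c%:P + g *: 'X^k)); split.
(* Since k < 2n, removing the constant and the X^k term leaves the top coefficient of A^2 + B^2
   intact. *)
- rewrite size_polyDl // size_polyN szAB.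
  apply: leq_ltn_trans (size_polyD _ _) _; rewrite gtn_max; apply/andP; split.
    by apply: leq_ltn_trans (size_polyC_leq1 _) _; rewrite ltnS (leq_ltn_trans _ lt_k2n).
  by apply: leq_ltn_trans (size_scale_leq _ _) _; rewrite size_polyXn ltnS.
- have gapA j : (0 < j < k)%N -> A`_j = 0.
    by move=> hj; rewrite AE PE gap // mul0r.
  have gapB j : (0 < j < k)%N -> B`_j = 0.
    by move=> hj; rewrite BE PE gap // mul0r.
  have := dvdp_add (sqr_poly_gap k0 gapA) (sqr_poly_gap k0 gapB).
  congr (_ %| _); rewrite /c /g -!mul_polyC !(rmorphD, rmorphM) /=; ring.
- move=> a; rewrite /sqmod !sqr_normcE -Pa Re_horner_real Im_horner_real -P0 -AE -BE.
  rewrite -[_ * _ * v ^+ k]mulrA -PE !hornerE /=.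
  have -> : complex.Re ((P`_0)^* * P`_k) = A`_0 * A`_k + B`_0 * B`_k.
    by rewrite !AE !BE; case: (P`_0) (P`_k) => [x y] [x' y'] /=; rewrite mulNr opprK.
  rewrite -/A -/B /c /g; ring.
Qed.

(** Factor q = r X^(k+1). For 0 < a < 1, r(a) is at most the sum M of the absolute values of its
    coefficients, so g + r(a) a < 0 as soon as a (M + 1) < -g. The added 1 keeps the divisor
    positive when r = 0. *)
Lemma dominant_monomial_lt0 (R : realFieldType) (g : R) (k : nat) (q : {poly R}) :
    g < 0 -> 'X^(k.+1) %| q ->
  exists2 amax : R, 0 < amax &
    forall a, 0 < a -> a < amax -> g * a ^+ k + q.[a] < 0.
Proof.
move=> g0 /dvdpP[r ->].
pose M := \sum_(i < size r) `|r`_i|.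
have M0 : 0 <= M by apply: sumr_ge0 => i _.
have M1 : 0 < M + 1 by rewrite ltr_wpDl.
exists (Num.min 1 (- g / (M + 1))).
  by rewrite lt_min ltr01 divr_gt0 // oppr_gt0.
move=> a a0; rewrite lt_min => /andP[a1 a_lt].
have r_le : r.[a] <= M.
  rewrite horner_coef; apply: ler_sum => i _.
  apply: le_trans (ler_norm _) _; rewrite normrM normrX (gtr0_norm a0).
  by rewrite ler_piMr // exprn_ile1 // ltW.
rewrite hornerM hornerXn exprS.
have -> : g * a ^+ k + r.[a] * (a * a ^+ k) = (g + r.[a] * a) * a ^+ k by ring.
rewrite pmulr_llt0 ?exprn_gt0 //.
move: a_lt; rewrite ltr_pdivlMr // => a_lt; nra.
Qed.

Lemma expi_exp (R : realType) (t : R) (k : nat) :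
  expi t ^+ k = expi (k%:R * t).
Proof.
elim: k => [|k IHk]; first by rewrite mul0r /expi cos0 sin0.
rewrite exprS IHk -natr1 mulrDl mul1r /expi addrC cosD sinD.
by congr Complex; rewrite [cos t * sin _ + _]addrC.
Qed.

Lemma expi_neq0 (R : realType) (t : R) : expi t != 0.
Proof.
apply/eqP => -[c0 s0]; have := cos2Dsin2 t.
by rewrite c0 s0 expr0n addr0 => /eqP; rewrite eq_sym oner_eq0.
Qed.

(** Quarter turns suffice: if Re w is nonzero, rotate by 0 or pi; otherwise a turn by pi/2 or -pi/2
    brings the imaginary part onto the negative real axis. *)
Lemma exists_Re_expi_lt0 (R : realType) (w : R[i]) :
  w != 0 -> exists t : R, complex.Re (w * expi t) < 0.
Proof.
case: w => x y w0.
have [x0|x0|x0] := ltgtP x 0.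
- by exists 0; rewrite /= cos0 sin0 mulr1 mulr0 subr0.
- by exists pi; rewrite /= cospi sinpi mulrN1 mulr0 subr0 oppr_lt0.
have [y0|y0|y0] := ltgtP y 0.
- by exists (- (pi / 2)); rewrite /= cosN sinN cos_pihalf sin_pihalf mulr0 mulrN1 sub0r opprK.
- by exists (pi / 2); rewrite /= cos_pihalf sin_pihalf mulr0 mulr1 sub0r oppr_lt0.
by rewrite x0 y0 eqxx in w0.
Qed.

Lemma conjcE (R : rcfType) (z : R[i]) : z^* = complex.Re z -i* complex.Im z.
Proof. by case: z. Qed.

(** The two summands of [Gk] are conjugate to each other. This form matches the coefficient of a^k
    in [sqmod_along_line]. *)
Lemma Gk_Re (R : realType) (k : nat) (u z : R[i]) :
  Gk k u z = (2 * complex.Re (u^* * z ^+ k))%:C.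
Proof.
by rewrite /Gk -[u in X in _ + X]conjCK -!rmorphXn -rmorphM [LHS]addcJ rmorphM rmorph_nat.
Qed.

Lemma Gk_polar (R : realType) (k : nat) (u : R[i]) (alpha theta : R) :
    (0 < k)%N ->
  let gamma : R[i] := u ^+ k.-1 + (u^*) ^+ k.-1 in
  let delta : R[i] := 'i * (u ^+ k.-1 - (u^*) ^+ k.-1) in
  Gk k u (alpha%:C * expi theta * u) =
    (alpha ^+ k)%:C * `|u| ^+ 2
      * (gamma * (cos (k%:R * theta))%:C + delta * (sin (k%:R * theta))%:C).
Proof.
move=> k0 gamma delta; rewrite /gamma /delta /Gk normCK.
have conj_alpha : (alpha%:C)^* = alpha%:C by rewrite conjcE /= oppr0.
rewrite !(rmorphM, rmorphXn) /= conj_alpha !exprMn -[(expi theta)^* ^+ k]rmorphXn /=.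
rewrite expi_exp; set c := (cos _)%:C; set s := (sin _)%:C.
have expiE : expi (k%:R * theta) = c + 'i * s.
  by rewrite [LHS]complexE.
have expiJ : (expi (k%:R * theta))^* = c - 'i * s.
  by rewrite expiE rmorphD rmorphM /= conjCi mulNr !conjcE /= oppr0.
(* With k a successor, one factor u splits off u^k and pairs with the conjugate of u to give
   |u|^2. *)
rewrite expiJ expiE; case: (k) k0 => // m _; rewrite !exprS /=; ring.
Qed.

Theorem theorem1 (R : realType) (p : {poly R[i]}) (n : nat)
    (hdeg : size p = n.+1) (hn : (1 <= n)%N)
    (z0 : R[i]) (hz0 : p.[z0] != 0)
    (k : nat) (hk : smallest_nonvanishing_derivative p z0 k) :
  let F : R[i] -> R := sqmod p in
  let u : R[i] := (k`!%:R)^-1 * p.[z0] * (p^`(k).[z0])^* in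
  let gamma : R[i] := u ^+ k.-1 + (u^*) ^+ k.-1 in
  let delta : R[i] := 'i * (u ^+ k.-1 - (u^*) ^+ k.-1) in
  [/\ forall z : R[i],
        (F z)%:C = `|p.[z]| ^+ 2 /\ `|p.[z]| ^+ 2 = p.[z] * (p.[z])^*,
      gamma \is Num.real /\ delta \is Num.real,
      forall theta : R,
        exists q : {poly R},
          [/\ size q = (2 * n).+1,
              exists2 l : nat, (k < l)%N & 'X^l %| q &
              forall alpha : R, 0 < alpha ->
                let w : R[i] := alpha%:C * expi theta * u in
                [/\ (F (z0 + w) - F z0)%:C
                      = `|p.[z0 + w]| ^+ 2 - `|p.[z0]| ^+ 2,
                    (F (z0 + w) - F z0)%:C = Gk k u w + (q.[alpha])%:C &
                    Gk k u w
                      = (alpha ^+ k)%:C * `|u| ^+ 2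
                        * (gamma * (cos (k%:R * theta))%:C
                           + delta * (sin (k%:R * theta))%:C)]] &
      exists theta : R, descent_direction F z0 (expi theta * u)].
Proof.
case: hk => k0 pk0 k_min F u gamma delta.
have facE (m : nat) : m`!%:R != 0 :> R[i] by rewrite pnatr_eq0 -lt0n fact_gt0.
have taylorE j : p^`N(j).[z0] = j`!%:R^-1 * p^`(j).[z0].
  by rewrite nderivn_def hornerMn -[X in _ * X]mulr_natl mulKf.
(* This identifies the coefficient of a^k along a direction v as 2 Re (conj(u) v^k), which links the
   Taylor expansion to [Gk]. *)
have uJ : u^* = p.[z0]^* * p^`N(k).[z0].
  by rewrite taylorE /u !rmorphM /= fmorphV rmorph_nat conjCK mulrCA mulrA.
have u0 : u != 0.
  by rewrite /u !mulf_neq0 ?invr_eq0 ?fmorph_eq0 // facE.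
have gap j : (0 < j < k)%N -> p^`N(j).[z0] = 0.
  case/andP=> j0 lt_jk; rewrite taylorE; apply/eqP; rewrite mulf_eq0.
  apply/orP; right; apply: contraLR lt_jk => pj0; rewrite -leqNgt; exact: k_min.
have le_kn : (k <= n)%N.
  rewrite -ltnS -hdeg ltnNge; apply: contra pk0 => szp.
  by rewrite derivn_poly0 ?horner0.
have lt_k2n : (0 < k < 2 * n)%N.
  by rewrite k0 (leq_ltn_trans le_kn) // mul2n -addnn -[X in (X < _)%N]addn0 ltn_add2l.
have liftE z : (F z)%:C = `|p.[z]| ^+ 2 by exact: normc_lift.
have expansion theta : exists q : {poly R}, [/\ size q = (2 * n).+1, 'X^(k.+1) %| q &
    forall a : R, F (z0 + a%:C * (expi theta * u)) - F z0
      = 2 * complex.Re (u^* * (expi theta * u) ^+ k) * a ^+ k + q.[a]].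
  by rewrite uJ; apply: sqmod_along_line => //; rewrite mulf_neq0 ?expi_neq0.
split.
- by move=> z; rewrite -normCK.
- have conjX (m : nat) : (u ^+ m)^* = u^* ^+ m by rewrite rmorphXn.
  (* Both numbers are fixed by conjugation: it swaps the summands of [gamma], and in [delta] the two
     sign changes cancel. *)
  split; apply/CrealP; rewrite /gamma /delta -!conjX.
    by rewrite rmorphD /= conjCK addrC.
  by rewrite rmorphM rmorphB /= conjCK conjCi mulNr -mulrN opprB.
- move=> theta; have [q [szq dvdq expq]] := expansion theta.
  exists q; split=> //; first by exists k.+1.
  move=> alpha _ w; split; last exact: Gk_polar.
    by rewrite rmorphB /= !liftE.
  rewrite Gk_Re -rmorphD /=; congr (_%:C); rewrite /w -mulrA expq; congr (_ + _).
  rewrite [in RHS]exprMn [in RHS]mulrCA -rmorphXn /=.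
  by case: (u^* * _) => x y /=; ring.
- have [t t_lt0] := exists_Re_expi_lt0 (expf_neq0 k.-1 u0).
  (* Dividing by k makes e^(i k theta) = e^(it), where t turns u^(k-1) into the left half-plane. *)
  exists (t / k%:R); have [q [_ dvdq expq]] := expansion (t / k%:R).
  have g0 : 2 * complex.Re (u^* * (expi (t / k%:R) * u) ^+ k) < 0.
    rewrite exprMn expi_exp.
    have -> : k%:R * (t / k%:R) = t by rewrite mulrC divfK // pnatr_eq0 -lt0n.
    (* Splitting off the positive factor |u|^2 leaves u^(k-1) e^(it), whose real part is negative by
       the choice of t. *)
    have -> : u^* * (expi t * u ^+ k) = (Normc.normc u ^+ 2)%:C * (u ^+ k.-1 * expi t).
      by rewrite normc_lift normCK; case: (k) k0 => // m _; rewrite exprS /=; ring.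
    case: (u ^+ k.-1 * _) t_lt0 => x y /= x0.
    by rewrite mul0r subr0 pmulr_rlt0 // pmulr_rlt0 // -ltcR normc_lift exprn_gt0 ?normr_gt0.
  have [amax amax0 neg] := dominant_monomial_lt0 g0 dvdq.
  by exists amax => // a a0 a_lt; rewrite -subr_lt0 expq neg.
Qed.
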